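(* There exists an absolute constant $K>0$ such that for every real $w>2$, every integer $n\ge 2$ and every symmetric equilibrium $S$ of the game $G(n;w)$, $$n-1\le c_{n,w}(S)\le n+K\, w\,\ln n .$$ (That is, $n-1\leq c_{n,w}(S) \leq n + w \cdot O(\ln n)$.)
   Context: The game $G(n;w)$ ($n\ge 2$ an integer, $w>1$ real): there are $n$ agents and discrete time steps $t=1,2,3,\dots$. Initially all agents are outside an empty first-come-first-served queue. At each time step: (1) each agent still outside decides, simultaneously with the others and possibly using independent randomization, whether to enter the queue; (2) all agents who decided to enter are appended to the end of the queue in uniformly random order; (3) if the queue is nonempty, the first agent in it is processed and leaves, and each remaining agent in the queue incurs cost $w$; (4) each agent outside the queue incurs cost $1$. Each agent minimizes his expected total cost (possibly $+\infty$). The state at the start of a step is $(m,k)$, where $m\ge1$ agents are still outside and $k\ge 0$ agents are in the queue, $m+k\le n$. An anonymous stationary strategy specifies, for each state $(m,k)$, a probability $q_{m,k}\in[0,1]$ of entering, used whenever that state occurs. A profile is symmetric if all agents use the same strategy. A symmetric equilibrium is a symmetric profile of anonymous stationary strategies in which no agent can strictly decrease his expected cost by unilaterally deviating to another anonymous stationary strategy. $c_{n,w}(S)$ is the expected cost of each agent under the symmetric profile $S$. *)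

(* Defs.v *)
From mathcomp Require Import all_boot all_order all_algebra.
From mathcomp Require Import reals ereal sequences exp.

Set Implicit Arguments.
Unset Strict Implicit.
Unset Printing Implicit Defensive.

Import Order.TTheory GRing.Theory Num.Theory.

Local Open Scope ring_scope.

(* Agents in neither [outside] nor [queue] have already been processed.
   The head of [queue] is the next agent to be processed. *)
Record game_state (n : nat) := GameState {
  outside : {set 'I_n};
  queue : seq 'I_n
}.

Definition initial_state (n : nat) : game_state n :=
  GameState [set: 'I_n] [::].

(* Anonymous stationary strategies: [q m k] is the probability of entering when
   m agents are outside and k agents are queued. The values of [q] outside the
   range constrained by [is_strategy] are never used in the game. *)
Definition strategy (R : realType) := nat -> nat -> R.

Definition is_strategy (R : realType) (n : nat) (q : strategy R) : Prop :=
  forall m k : nat, (1 <= m)%N -> (m + k <= n)%N -> 0 <= q m k <= 1.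

Definition profile (R : realType) (n : nat) := 'I_n -> strategy R.

Definition symmetric_profile (R : realType) (n : nat) (q : strategy R) :
  profile R n := fun _ => q.

Definition deviate (R : realType) (n : nat) (P : profile R n) (i : 'I_n)
  (p : strategy R) : profile R n := fun j => if j == i then p else P j.

(* [E] is the set of agents that decide to enter at this step. *)
Definition entry_prob (R : realType) (n : nat) (P : profile R n)
  (s : game_state n) (E : {set 'I_n}) : R :=
  \prod_(j in outside s)
    (let x := P j #|outside s| (size (queue s)) in
     if j \in E then x else 1 - x).

(* [r] lists the agents entering at this step, in their order of arrival. *)
Definition next_state (n : nat) (s : game_state n) (r : seq 'I_n) :
  game_state n :=
  GameState (outside s :\: [set j in r]) (behead (queue s ++ r)).

Definition step_expectation (R : realType) (n : nat) (P : profile R n)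
  (f : game_state n -> R) (s : game_state n) : R :=
  \sum_(E : {set 'I_n} | E \subset outside s)
    entry_prob P s E *
    ((\sum_(r <- permutations (enum E)) f (next_state s r)) / (#|E|`!)%:R).

(* The expectation of [f] at the random state reached from [s] after t steps. *)
Definition expectation_after (R : realType) (n : nat) (P : profile R n)
  (t : nat) (f : game_state n -> R) : game_state n -> R :=
  iter t (step_expectation P) f.

(* The cost incurred by agent i during a step, as a function of the state [s]
   at the end of that step, after the head of the queue has left. *)
Definition step_cost (R : realType) (n : nat) (w : R) (i : 'I_n)
  (s : game_state n) : R :=
  if i \in outside s then 1 else if i \in queue s then w else 0.

(* The costs being nonnegative, the expectation of the total cost is the sum
   of the expected costs of the individual steps; it may be +oo. *)
Definition expected_cost (R : realType) (n : nat) (w : R) (P : profile R n)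
  (i : 'I_n) : \bar R :=
  (\sum_(0 <= t <oo)
    (expectation_after P t.+1 (step_cost w i) (initial_state n))%:E)%E.

Definition symmetric_equilibrium (R : realType) (n : nat) (w : R)
  (q : strategy R) : Prop :=
  is_strategy n q /\
  forall (i : 'I_n) (p : strategy R), is_strategy n p ->
    ~ (expected_cost w (deviate (symmetric_profile q) i p) i
       < expected_cost w (symmetric_profile q) i)%E.

(* Main.v *)
(* For an agent who is still outside, the game reduces to a Markov decision problem
   on the pairs (m, k): entering costs w (k + (m-1) q / 2) on average, since a
   queueing agent pays w times his position, and waiting costs 1 plus the cost at the
   next state, where the number e of other entrants is binomial.

   Upper bound: let one agent wait until he is alone, except that he enters at (m, 0)
   when q(m, 0) <= 2 / w. Entering there costs at most m - 1; when he waits at (m, 0)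
   instead, the others stay idle with probability at most (1 - 2 / w)^(m-1), that is,
   for at most w / (2 (m - 1)) steps on average. In total he pays at most
   n - 1 + (w / 2) H_(n-1).

   Lower bound: at every state (m, k) reached with positive probability, entering is
   no better than the equilibrium cost V, so V is at least the cost of waiting if
   q < 1, while V = w (k + (m-1) / 2) >= 2 k + m - 1 if q = 1. Induction on m + k
   then gives V >= m + k - 1. *)
Require Import Defs.
From mathcomp Require Import all_boot all_order all_algebra.
From mathcomp Require Import boolp classical_sets topology normedtype.
From mathcomp Require Import reals ereal sequences exp.
From mathcomp Require Import ring lra zify.

Set Implicit Arguments.
Unset Strict Implicit.
Unset Printing Implicit Defensive.

Import Order.TTheory GRing.Theory Num.Theory.
Import numFieldNormedType.Exports.

Local Open Scope classical_set_scope.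
Local Open Scope ring_scope.

(** * Binomial means *)

Section BinomialMean.
Variable R : realType.
Implicit Types (x c : R) (f g : nat -> R).

Definition binom_weight (j : nat) x (e : nat) : R :=
  'C(j, e)%:R * x ^+ e * (1 - x) ^+ (j - e).

Definition binom_mean (j : nat) x f : R :=
  \sum_(e < j.+1) binom_weight j x e * f e.

Lemma binom_weight_ge0 j x e : 0 <= x <= 1 -> 0 <= binom_weight j x e.
Proof.
move=> /andP[x0 x1]; rewrite /binom_weight !mulr_ge0 ?exprn_ge0 ?ler0n //.
by rewrite subr_ge0.
Qed.

Lemma sum_binom_weight j x : \sum_(e < j.+1) binom_weight j x e = 1.
Proof.
rewrite -[RHS](expr1n _ j) -[in RHS](subrK x 1) exprDn; apply: eq_bigr => e _.
by rewrite /binom_weight -mulr_natl; ring.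
Qed.

Lemma binom_mean_cst j x a : binom_mean j x (fun=> a) = a.
Proof. by rewrite /binom_mean -mulr_suml sum_binom_weight mul1r. Qed.

Lemma binom_mean_affine j x a c f :
  binom_mean j x (fun e => a + c * f e) = a + c * binom_mean j x f.
Proof.
rewrite -[a in RHS]mulr1 -(sum_binom_weight j x) /binom_mean !mulr_sumr -big_split.
by apply: eq_bigr => e _ /=; ring.
Qed.

Lemma binom_mean_id j x : binom_mean j x (fun e => e%:R) = j%:R * x.
Proof.
rewrite /binom_mean big_ord_recl mulr0 add0r.
case: j => [|j]; first by rewrite big_ord0 mul0r.
transitivity (j.+1%:R * x * \sum_(e < j.+1) binom_weight j x e); last first.
  by rewrite sum_binom_weight mulr1.
rewrite mulr_sumr; apply: eq_bigr => e _.
rewrite lift0 /binom_weight subSS exprS.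
have /(congr1 (fun k => k%:R : R)) := mul_bin_diag j.+1 e.
rewrite !natrM /= => E.
transitivity ((e.+1%:R * 'C(j.+1, e.+1)%:R) * (x * x ^+ e * (1 - x) ^+ (j - e))).
  by ring.
by rewrite -E; ring.
Qed.

Lemma binom_mean_at0 j x : binom_mean j x (fun e => (e == 0%N)%:R) = (1 - x) ^+ j.
Proof.
rewrite /binom_mean big_ord_recl big1 => [|e _]; last by rewrite mulr0.
by rewrite /binom_weight bin0 subn0 expr0 !mulr1 mul1r addr0.
Qed.

Lemma le_binom_mean j x f g : 0 <= x <= 1 ->
  (forall e, (e <= j)%N -> binom_weight j x e != 0 -> f e <= g e) ->
  binom_mean j x f <= binom_mean j x g.
Proof.
move=> x01 fg; apply: ler_sum => e _.
have [->|Ne] := eqVneq (binom_weight j x e) 0; first by rewrite !mul0r.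
by rewrite ler_wpM2l ?binom_weight_ge0 ?fg // -ltnS.
Qed.

End BinomialMean.

(** * The decision problem of an agent outside *)

Section Recursion.
Variables (R : realType) (n : nat) (w : R) (q : strategy R).
Hypotheses (w2 : 2 < w) (q_strat : is_strategy n q).
Implicit Types (p : strategy R) (u : nat -> nat -> R) (m k : nat).

Definition enter_cost m k : R := w * (k%:R + m.-1%:R * q m k / 2).

(* When [k = e = 0] nobody is processed and [(k + e).-1 = 0] is still the next
   queue length. *)
Definition wait_cost u m k : R :=
  1 + binom_mean m.-1 (q m k) (fun e => u (m - e)%N (k + e).-1).

Definition round_cost p u m k : R :=
  p m k * enter_cost m k + (1 - p m k) * wait_cost u m k.

(** Truncation limits only the number of rounds spent outside: an entry within them is charged in
    full at once. *)
Definition cost_upto p (N : nat) : nat -> nat -> R :=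
  iter N (round_cost p) (fun _ _ => 0).

(** * The late-entry bound and its harmonic sum *)

Definition harmonic_sum (j : nat) : R := \sum_(i < j) i.+1%:R^-1.

Lemma harmonic_sum_ge0 j : 0 <= harmonic_sum j.
Proof. by apply: sumr_ge0 => i _; rewrite invr_ge0. Qed.

Lemma le_harmonic_sum i j : (i <= j)%N -> harmonic_sum i <= harmonic_sum j.
Proof.
move=> /subnKC <-; rewrite /harmonic_sum big_split_ord /= lerDl.
by apply: sumr_ge0 => l _; rewrite invr_ge0.
Qed.

(** Termwise, [ln (1 - 1/(x+1)) <= -1/(x+1)] gives [1/(x+1) <= ln (x+1) - ln x], and
    [1/x <= 2/(x+1)] for [x >= 1]. The factor 2 cancels against the [w / 2] of the late-entry
    bound. *)
Lemma harmonic_sum_le_ln j : harmonic_sum j <= 2 * ln j.+1%:R.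
Proof.
elim: j => [|j IH]; first by rewrite /harmonic_sum big_ord0 ln1 mulr0.
rewrite /harmonic_sum big_ord_recr /=.
suff: (j.+1%:R : R)^-1 <= 2 * (ln j.+2%:R - ln j.+1%:R).
  move=> D; apply: le_trans (lerD IH D) _; lra.
rewrite -(natr1 j.+1); have : 1 <= j.+1%:R :> R by rewrite ler1n.
move: (j.+1%:R : R) => x x1.
have : ln (x / (x + 1)) <= - (x + 1)^-1.
  have -> : x / (x + 1) = 1 + - (x + 1)^-1 by field; lra.
  by apply: le_ln1Dx; rewrite ltrN2 invf_lt1; lra.
rewrite ln_div ?posrE; [|lra..].
suff : x^-1 <= 2 * (x + 1)^-1 by lra.
rewrite -subr_ge0.
have -> : 2 * (x + 1)^-1 - x^-1 = (x - 1) / (x * (x + 1)) by field; apply/andP; split; lra.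
by rewrite divr_ge0 ?mulr_ge0; lra.
Qed.

(* Entering an empty queue where [q m 0 <= 2 / w] costs at most [m - 1], so that
   no assumption on [q] is needed to bound the idle time. *)
Definition late_entry : strategy R :=
  fun m k => ((k == 0%N) && ((m == 1%N) || (q m k <= 2 / w)))%:R.

Lemma late_entry_strategy : is_strategy n late_entry.
Proof. by move=> m k _ _; rewrite /late_entry ler0n lern1 leq_b1. Qed.

(** Bernoulli's inequality, then [(1 - x) (1 + x) <= 1]. With [r] the probability that [j] others
    all stay idle, this bounds the mean number [r / (1 - r)] of idle steps by [1 / (j x)]. *)
Lemma idle_weight_le j (x : R) : 0 <= x <= 1 -> (1 - x) ^+ j * (1 + j%:R * x) <= 1.
Proof.
move=> /andP[x0 x1].
have b : 1 + j%:R * x <= (1 + x) ^+ j.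
  elim: j => [|j IH]; first by rewrite expr0; lra.
  rewrite exprS -natr1; apply: le_trans (ler_wpM2l _ IH); last by lra.
  have : 0 <= j%:R * x * x by rewrite !mulr_ge0.
  lra.
apply: le_trans (ler_wpM2l _ b) _; first by rewrite exprn_ge0 // subr_ge0.
by rewrite -exprMn exprn_ile1 //; nra.
Qed.

Lemma late_entry_bound N m k : (1 <= m)%N -> (m + k <= n)%N ->
  cost_upto late_entry N m k <= (m + k).-1%:R + w / 2 * harmonic_sum m.-1.
Proof.
have w2l := w2; have w20 : 0 <= w / 2 by lra.
elim: N m k => [|N IH] m k m1 mkn.
  by rewrite addr_ge0 ?ler0n ?(mulr_ge0 w20) ?harmonic_sum_ge0.
have q01 := q_strat m1 mkn.
rewrite /cost_upto iterS -/(cost_upto late_entry N) /round_cost /late_entry.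
case mq: (_ && _).
  case/andP: mq => /eqP k0; subst k => mq.
  rewrite /= mul1r subrr mul0r addr0 /enter_cost addn0 mulr0n add0r.
  apply: ler_wpDr; first by rewrite mulr_ge0 ?harmonic_sum_ge0.
  case/orP: mq => [/eqP ->|qw]; first by rewrite /= !mul0r mulr0.
  have : q m 0%N * w <= 2 by rewrite -ler_pdivlMr //; lra.
  move=> /(ler_wpM2l (ler0n R m.-1)); lra.
rewrite /= mul0r add0r subr0 mul1r /wait_cost.
case: k mkn mq q01 => [|k] mkn mq q01.
  case: m m1 mkn mq q01 => [//|[//|m]] _ mkn /= /negbT; rewrite -ltNge => wq q01.
  (* [c] bounds the cost after a step in which somebody else enters, since one agent has then been
     processed; [x] is [w / 2] times the last term of the harmonic sum at [m.+2]. *)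
  set c := m%:R + w / 2 * harmonic_sum m; set x := w / 2 / m.+1%:R.
  have g_cd : (m.+2 + 0).-1%:R + w / 2 * harmonic_sum m.+1 = c + (1 + x).
    rewrite addn0 /= -natr1 /harmonic_sum big_ord_recr /= -/(harmonic_sum m) /c /x.
    by rewrite mulrDr; ring.
  have x0 : 0 < x by rewrite /x divr_gt0 ?ltr0n //; lra.
  have mean_le : binom_mean m.+1 (q m.+2 0%N)
      (fun e => cost_upto late_entry N (m.+2 - e)%N (0 + e).-1) <=
      c + (1 + x) * (1 - q m.+2 0%N) ^+ m.+1.
    rewrite -binom_mean_at0 -binom_mean_affine; apply: le_binom_mean => // -[|e] e_le _.
      by rewrite mulr1 -g_cd subn0; apply: IH.
    rewrite mulr0 addr0; apply: (le_trans (IH _ _ _ _)); [lia|lia|].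
    rewrite (_ : (m.+2 - e.+1 + (0 + e.+1).-1).-1 = m); last by lia.
    rewrite lerD2l ler_wpM2l // le_harmonic_sum //; lia.
  rewrite g_cd; apply: le_trans (lerD (lexx 1) mean_le) _.
  have := idle_weight_le m.+1 q01.
  have : 0 <= (1 - q m.+2 0%N) ^+ m.+1 by rewrite exprn_ge0 // subr_ge0; case/andP: q01.
  move: ((1 - _) ^+ _) => r r0 rle.
  (* This is where [q m.+2 0 > 2 / w] enters. It gives [r <= r x (m+1) q], which added to [x] times
     the idle bound yields [r (1 + x) <= x]. *)
  have xq : 1 <= x * (m.+1%:R * q m.+2 0%N).
    rewrite /x mulrA divfK ?pnatr_eq0 //.
    by move: wq; rewrite ltr_pdivrMr; lra.
  have : r * (1 + x) <= x.
    have := ler_wpM2l r0 xq; have := ler_wpM2l (ltW x0) rle; lra.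
  lra.
(* With a nonempty queue exactly one agent is processed, whoever enters, so the 1 paid for waiting
   is matched by the drop of [m + k]. *)
suff : binom_mean m.-1 (q m k.+1)
    (fun e => cost_upto late_entry N (m - e)%N (k.+1 + e).-1) <=
    (m + k).-1%:R + w / 2 * harmonic_sum m.-1.
  rewrite (_ : (m + k.+1).-1 = (m + k).-1.+1); last by lia.
  by rewrite -natr1; lra.
rewrite -[leRHS](binom_mean_cst m.-1 (q m k.+1)); apply: le_binom_mean => // e e_le _.
apply: (le_trans (IH _ _ _ _)); [lia|lia|].
rewrite (_ : (m - e + (k.+1 + e).-1) = m + k)%N; last by lia.
rewrite lerD2l ler_wpM2l // le_harmonic_sum //; lia.
Qed.

(** * Comparison of truncated costs, and reachable states *)

Lemma enter_cost_ge0 m k : (1 <= m)%N -> (m + k <= n)%N -> 0 <= enter_cost m k.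
Proof.
move=> m1 mkn; have /andP[q0 _] := q_strat m1 mkn.
by rewrite /enter_cost mulr_ge0 ?(le_trans _ (ltW w2)) // addr_ge0 ?divr_ge0 ?mulr_ge0.
Qed.

(** Carries a gap at one successor back to the present state, scaled by the weight of that
    successor. It serves both to transfer bounds along transitions and to propagate a strict
    improvement. *)
Lemma le_wait_cost_gap u v m k e d : (1 <= m)%N -> (m + k <= n)%N -> (e <= m.-1)%N ->
  (forall e, (e <= m.-1)%N -> binom_weight m.-1 (q m k) e != 0 ->
    u (m - e)%N (k + e).-1 <= v (m - e)%N (k + e).-1) ->
  u (m - e)%N (k + e).-1 + d <= v (m - e)%N (k + e).-1 ->
  wait_cost u m k + binom_weight m.-1 (q m k) e * d <= wait_cost v m k.
Proof.
move=> m1 mkn em uv uvd; have q01 := q_strat m1 mkn.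
rewrite /wait_cost -addrA lerD2l /binom_mean.
have em' : (e < m.-1.+1)%N by rewrite ltnS.
rewrite (bigD1 (Ordinal em')) //= [leRHS](bigD1 (Ordinal em')) //=.
rewrite addrAC -mulrDr lerD ?ler_wpM2l ?binom_weight_ge0 //.
apply: ler_sum => j _.
have [->|Nj] := eqVneq (binom_weight m.-1 (q m k) j) 0; first by rewrite !mul0r.
by rewrite ler_wpM2l ?binom_weight_ge0 // uv // -ltnS.
Qed.

(** Only successors of nonzero probability are compared, because [value] is controlled at reachable
    states alone. *)
Lemma le_round_cost p u v m k : is_strategy n p -> (1 <= m)%N -> (m + k <= n)%N ->
  (forall e, (e <= m.-1)%N -> p m k != 1 -> binom_weight m.-1 (q m k) e != 0 ->
    u (m - e)%N (k + e).-1 <= v (m - e)%N (k + e).-1) ->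
  round_cost p u m k <= round_cost p v m k.
Proof.
move=> p_strat m1 mkn uv; rewrite /round_cost lerD2l.
have [->|p1] := eqVneq (p m k) 1; first by rewrite subrr !mul0r.
have /andP[_ p_le1] := p_strat _ _ m1 mkn; rewrite ler_wpM2l ?subr_ge0 //.
rewrite lerD2l; apply: le_binom_mean; first exact: q_strat.
by move=> e em we; apply: uv.
Qed.

Lemma cost_upto_mono p N m k : is_strategy n p -> (1 <= m)%N -> (m + k <= n)%N ->
  0 <= cost_upto p N m k <= cost_upto p N.+1 m k.
Proof.
move=> p_strat; elim: N m k => [|N IH] m k m1 mkn.
  rewrite lexx /= /round_cost.
  have /andP[p0 p1] := p_strat _ _ m1 mkn.
  rewrite addr_ge0 ?(mulr_ge0 p0) ?enter_cost_ge0 // mulr_ge0 ?subr_ge0 //.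
  by rewrite /wait_cost binom_mean_cst addr0.
have step : cost_upto p N.+1 m k <= cost_upto p N.+2 m k.
  apply: le_round_cost => // e em _ _.
  by have /andP[] := IH (m - e)%N (k + e).-1 ltac:(lia) ltac:(lia).
rewrite step andbT.
by have /andP[h0 h1] := IH m k m1 mkn; apply: le_trans h1.
Qed.

(* The states that occur with positive probability while a given agent following
   [q] is still outside. *)
Inductive reachable : nat -> nat -> Prop :=
| reachable_init : reachable n 0
| reachable_wait m k e : reachable m k -> (e <= m.-1)%N -> q m k != 1 ->
    binom_weight m.-1 (q m k) e != 0 -> reachable (m - e) (k + e).-1.

Hypothesis n_gt0 : (0 < n)%N.

Lemma reachable_valid m k : reachable m k -> (1 <= m)%N /\ (m + k <= n)%N.
Proof. by elim=> [|m' k' e _ [m1 mkn] em _ _]; [rewrite addn0|lia]. Qed.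

(** The equilibrium condition phrased through real bounds [M], so that infinite costs need no
    separate treatment. *)
Hypothesis q_optimal : forall p M, is_strategy n p ->
  (forall N, cost_upto p N n 0 <= M) -> forall N, cost_upto q N n 0 <= M.

(** Late entry has bounded cost from the initial state, so by optimality [q] has too. Along a
    transition, a bound divided by the transition probability is a bound at the successor. *)
Lemma reachable_bounded m k : reachable m k ->
  exists M, forall N, cost_upto q N m k <= M.
Proof.
elim=> [|m' k' e /reachable_valid[m1 mkn] [M HM] em q1 we].
  eexists; apply: q_optimal late_entry_strategy _ => N.
  by apply: late_entry_bound; rewrite ?addn0.
have /andP[q0 q_le1] := q_strat m1 mkn.
have q_lt1 : 0 < 1 - q m' k' by rewrite subr_gt0 lt_neqAle q1.
have we0 : 0 < binom_weight m'.-1 (q m' k') e.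
  by rewrite lt_neqAle eq_sym we binom_weight_ge0 ?q0.
exists (M / ((1 - q m' k') * binom_weight m'.-1 (q m' k') e)) => N.
rewrite ler_pdivlMr ?(mulr_gt0 q_lt1 we0) // mulrC -mulrA; apply: le_trans (HM N.+1).
rewrite /cost_upto iterS /round_cost.
apply: ler_wpDl; first by rewrite mulr_ge0 ?enter_cost_ge0.
rewrite ler_pM2l //.
apply: le_trans (@le_wait_cost_gap (fun=> fun=> 0) (cost_upto q N) _ _ e
  (cost_upto q N (m' - e)%N (k' + e).-1) m1 mkn em _ _).
- by rewrite /wait_cost binom_mean_cst addr0 lerDr.
- move=> j jm _.
  by have /andP[] := @cost_upto_mono q N (m' - j) (k' + j).-1 q_strat ltac:(lia) ltac:(lia).
- by rewrite add0r.
Qed.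

(** * The limit of the truncated costs and its lower bound *)

Definition value m k : R := limn (fun N => cost_upto q N m k).

(** Monotone convergence; at an unreachable state the truncated costs may be unbounded and [value] a
    mere default. *)
Lemma cvg_value m k : reachable m k -> (fun N => cost_upto q N m k) @ \oo --> value m k.
Proof.
move=> mk; have [m1 mkn] := reachable_valid mk; have [M HM] := reachable_bounded mk.
apply: nondecreasing_is_cvgn.
  apply/nondecreasing_seqP => N.
  by have /andP[] := cost_upto_mono N q_strat m1 mkn.
by exists M => _ [N _ <-].
Qed.

Lemma cost_upto_le_value N m k : reachable m k -> cost_upto q N m k <= value m k.
Proof.
move=> mk; have [m1 mkn] := reachable_valid mk.
apply: (nondecreasing_cvgn_le (u_ := fun N => cost_upto q N m k)).
  apply/nondecreasing_seqP => j.
  by have /andP[] := cost_upto_mono j q_strat m1 mkn.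
by apply/cvg_ex; exists (value m k); apply: cvg_value.
Qed.

Lemma value_le m k M : reachable m k -> (forall N, cost_upto q N m k <= M) ->
  value m k <= M.
Proof.
move=> mk leM; apply: limr_le; first by apply/cvg_ex; exists (value m k); apply: cvg_value.
exact: nearW.
Qed.

(** Discards successors of probability zero, where no convergence is known. *)
Lemma cvg_scale_neq0 (c l : R) (f : nat -> R) : (c != 0 -> f @ \oo --> l) ->
  (fun N => c * f N) @ \oo --> c * l.
Proof.
have [->|c0 fl] := eqVneq c 0; last by apply: cvgM (fl isT); apply: cvg_cst.
by rewrite mul0r (_ : (fun N => _) = fun=> 0) => [_|];
  [apply: cvg_cst|apply/funext => N; rewrite mul0r].
Qed.

Lemma valueE m k : reachable m k -> round_cost q value m k = value m k.
Proof.
move=> mk.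
have lim1 : (fun N => cost_upto q N.+1 m k) @ \oo --> value m k.
  by rewrite (cvg_shiftS (fun N => cost_upto q N m k)); apply: cvg_value.
apply: cvg_unique lim1 => //.
change ((fun N => round_cost q (cost_upto q N) m k) @ \oo --> round_cost q value m k).
rewrite /round_cost; apply: cvgD; first exact: cvg_cst.
apply: cvg_scale_neq0; rewrite subr_eq0 eq_sym => q1.
apply: cvgD; first exact: cvg_cst.
rewrite /binom_mean; apply: cvg_big => [|e _]; first exact: add_continuous.
apply: cvg_scale_neq0 => we.
by apply: cvg_value; apply: reachable_wait; rewrite // -ltnS.
Qed.

(* Were entering at a reachable state strictly cheaper than following [q] from there,
   switching to entering at that state alone would lower the cost at all states from
   which it can be reached, hence at the initial one. *)
Lemma value_le_enter_cost m k : reachable m k -> value m k <= enter_cost m k.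
Proof.
move=> mk; rewrite leNgt; apply/negP => Elt.
pose p : strategy R := fun a b => if (a == m) && (b == k) then 1 else q a b.
have p_strat : is_strategy n p.
  move=> a b a1 abn; rewrite /p; case: ifP => _; last exact: q_strat.
  by rewrite ler01 lexx.
have p_at N : cost_upto p N m k <= enter_cost m k.
  case: N => [|N]; first by have [] := reachable_valid mk; apply: enter_cost_ge0.
  rewrite /cost_upto iterS /round_cost /p !eqxx /=.
  by rewrite mul1r subrr mul0r addr0.
have p_le N a b : reachable a b -> cost_upto p N a b <= value a b.
  elim: N a b => [|N IH] a b ab.
    exact: le_trans (cost_upto_le_value 0 ab).
  have [/andP[/eqP -> /eqP ->]|Nab] := boolP ((a == m) && (b == k)).
    exact: le_trans (p_at _) (ltW Elt).
  have [a1 abn] := reachable_valid ab.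
  have pq : p a b = q a b by rewrite /p (negbTE Nab).
  rewrite -(valueE ab) /cost_upto iterS.
  apply: (@le_trans _ _ (round_cost p value a b)); last by rewrite /round_cost pq.
  apply: le_round_cost => // e em p1 we.
  by apply: IH; apply: reachable_wait => //; rewrite -pq.
(* A deficit [d] of [p] below [value] passes to a predecessor, multiplied by the transition
   probability, and so on back to the initial state. *)
have back a b : reachable a b -> forall d, 0 < d ->
    (forall N, cost_upto p N a b <= value a b - d) ->
    exists2 d', 0 < d' & forall N, cost_upto p N n 0 <= value n 0 - d'.
  elim=> {a b} [|a b e ab IH em q1 we] d d0 Hd; first by exists d.
  have [a1 abn] := reachable_valid ab.
  (* If the predecessor is [(m, k)] itself, [p] enters there instead of waiting; the deficit starts
     afresh as [value m k - enter_cost m k]. *)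
  have [/andP[/eqP am /eqP bk]|Nab] := boolP ((a == m) && (b == k)).
    rewrite am bk in IH.
    apply: (IH (value m k - enter_cost m k)); first by rewrite subr_gt0.
    by move=> N; rewrite subKr.
  have pq : p a b = q a b by rewrite /p (negbTE Nab).
  have /andP[q0 q_le1] := q_strat a1 abn.
  have q_lt1 : 0 < 1 - q a b by rewrite subr_gt0 lt_neqAle q1.
  have we0 : 0 < binom_weight a.-1 (q a b) e.
    by rewrite lt_neqAle eq_sym we binom_weight_ge0 ?q0.
  apply: (IH ((1 - q a b) * (binom_weight a.-1 (q a b) e * d))).
    by rewrite mulr_gt0 // mulr_gt0.
  move=> N; have /andP[_ mono] := cost_upto_mono N p_strat a1 abn.
  apply: (le_trans mono); rewrite -(valueE ab) /cost_upto iterS -/(cost_upto p N).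
  rewrite /round_cost pq -addrA lerD2l -mulrBr ler_pM2l // lerBrDr.
  apply: le_wait_cost_gap => //.
    by move=> j jm wj; apply: p_le; apply: reachable_wait.
  by rewrite -lerBrDr; apply: Hd.
have [||d d0 Hd] := back _ _ mk (value m k - enter_cost m k).
- by rewrite subr_gt0.
- by move=> N; rewrite subKr.
have : value n 0 <= value n 0 - d.
  by apply: value_le reachable_init _ => N; apply: (q_optimal p_strat Hd).
by rewrite lerDl oppr_ge0 leNgt d0.
Qed.

(** By [valueE] the value is a convex combination of the costs of entering and of waiting; the first
    is at least the value and the second has positive weight. *)
Lemma wait_cost_le_value m k : reachable m k -> q m k != 1 ->
  wait_cost value m k <= value m k.
Proof.
move=> mk q1; have [m1 mkn] := reachable_valid mk.
have /andP[q0 q_le1] := q_strat m1 mkn.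
have q_lt1 : 0 < 1 - q m k by rewrite subr_gt0 lt_neqAle q1.
rewrite -(ler_pM2l q_lt1).
have := valueE mk; rewrite /round_cost => VE.
have := ler_wpM2l q0 (value_le_enter_cost mk).
lra.
Qed.

Lemma value_ge m k : reachable m k -> (m + k).-1%:R <= value m k.
Proof.
have [s] := ubnP (m + k)%N; elim: s m k => // s IH m k mks mk.
have [m1 mkn] := reachable_valid mk.
have q01 := q_strat m1 mkn; have wl := w2.
have [q1|q1] := eqVneq (q m k) 1.
  rewrite -(valueE mk) /round_cost q1 mul1r subrr mul0r addr0 /enter_cost q1.
  rewrite (_ : (m + k).-1 = (m.-1 + k)%N) ?natrD; last by lia.
  have : 0 <= (w - 2) * (k%:R + m.-1%:R * 1 / 2) :> R.
    by apply: mulr_ge0; [lra|rewrite addr_ge0 // mulr1 divr_ge0].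
  have := ler0n R k; lra.
case: k mks mk mkn q01 q1 => [|k] mks mk mkn q01 q1.
  case: m m1 mks mk mkn q01 q1 => [//|[|m]] _ mks mk mkn q01 q1.
    exact: (cost_upto_le_value 0 mk).
  (* With an empty queue the state repeats with probability [r], so the induction hypothesis covers
     only the other outcomes and [V] appears on both sides of [V_ge]. *)
  set r := (1 - q m.+2 0%N) ^+ m.+1; set V := value m.+2 0%N.
  have /andP[q0 q_le1] := q01.
  have r01 : 0 <= r <= 1.
    by rewrite /r exprn_ge0 ?exprn_ile1 // ?subr_ge0 // gerBl.
  have V_ge : 1 + (m%:R + (V - m%:R) * r) <= V.
    apply: le_trans (wait_cost_le_value mk q1).
    rewrite /wait_cost lerD2l /r -binom_mean_at0 -binom_mean_affine.
    apply: le_binom_mean => // -[|e] em we; first by rewrite mulr1 subn0 addrC subrK.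
    rewrite mulr0 addr0.
    apply: le_trans (IH _ _ _ (reachable_wait mk em q1 we)); last by lia.
    by rewrite ler_nat; lia.
  rewrite addn0 /= -natr1; case/andP: r01 => r0 r1.
  (* If [V >= m], the term with [r] is dropped. Otherwise [V_ge] would give [(V - m) (1 - r) >= 1]
     with a nonpositive left side. This avoids dividing by [1 - r], which may be 0. *)
  have [y0|/ltW y0] := lerP 0 (V - m%:R); first by have := mulr_ge0 y0 r0; lra.
  have : 0 <= (m%:R - V) * (1 - r) by rewrite mulr_ge0; lra.
  lra.
apply: le_trans (wait_cost_le_value mk q1).
rewrite (_ : (m + k.+1).-1 = (m + k).-1.+1); last by lia.
rewrite -natr1 /wait_cost addrC lerD2l -[leLHS](binom_mean_cst m.-1 (q m k.+1)).
apply: le_binom_mean => // e em we.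
apply: le_trans (IH _ _ _ (reachable_wait mk em q1 we)); last by lia.
by rewrite ler_nat; lia.
Qed.

End Recursion.

(** * Reduction of the game to the decision problem *)

Section SubsetSums.
Variables (R : realType) (T : finType).
Implicit Types (B E : {set T}) (x : T).

Lemma sum_subset_card B (F : nat -> R) :
  \sum_(E : {set T} | E \subset B) F #|E| = \sum_(e < #|B|.+1) 'C(#|B|, e)%:R * F e.
Proof.
rewrite (partition_big (fun E : {set T} => inord #|E| : 'I_#|B|.+1) xpredT) //=.
apply: eq_bigr => e _.
have -> : 'C(#|B|, e)%:R * F e =
    \sum_(E in [set E : {set T} | E \subset B & #|E| == e]) F e.
  by rewrite sumr_const cards_draws mulr_natl.
have inordE E : E \subset B -> (inord #|E| == e) = (#|E| == e).
  move=> EB; apply/eqP/eqP => [<-|Ee]; first by rewrite inordK // ltnS subset_leq_card.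
  by apply: val_inj; rewrite /= inordK // ltnS subset_leq_card.
apply: eq_big => [E|E /andP[EB]]; last by rewrite inordE // => /eqP ->.
by rewrite inE; case EB: (E \subset B) => //=; rewrite inordE.
Qed.

Lemma sum_subset_binom B (y : R) (F : nat -> R) :
  \sum_(E : {set T} | E \subset B)
    (\prod_(j in B) (if j \in E then y else 1 - y)) * F #|E| =
  binom_mean #|B| y F.
Proof.
pose G e := y ^+ e * (1 - y) ^+ (#|B| - e) * F e.
transitivity (\sum_(E : {set T} | E \subset B) G #|E|).
  apply: eq_bigr => E EB; rewrite /G; congr (_ * _).
  rewrite (bigID (mem E)) /=; congr (_ * _).
    rewrite (eq_bigr (fun=> y)) => [|j /andP[_ ->] //].
    rewrite prodr_const; congr (_ ^+ _); apply: eq_card => j.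
    by apply/andP/idP => [[]|jE]; last by split=> //; rewrite (fintype.subsetP EB j jE).
  rewrite (eq_bigr (fun=> 1 - y)) => [|j /andP[_ /negbTE ->] //].
  rewrite prodr_const -cardsDS //; congr (_ ^+ _); apply: eq_card => j.
  by rewrite inE andbC.
rewrite sum_subset_card /binom_mean; apply: eq_bigr => e _.
by rewrite /binom_weight /G !mulrA.
Qed.

(* Reversing a list pairs an index with its complement, so the mean index is
   half the largest one. *)
Lemma sum_index_permutations E x : x \in E ->
  \sum_(r <- permutations (enum E)) (index x r)%:R = (#|E|)`!%:R * (#|E|.-1%:R / 2) :> R.
Proof.
move=> xE; set S := LHS.
have rev_perm : perm_eq [seq rev r | r <- permutations (enum E)] (permutations (enum E)).
  apply: uniq_perm.
  - by rewrite map_inj_uniq ?permutations_uniq //; apply: can_inj revK.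
  - exact: permutations_uniq.
  - move=> r; rewrite -[r in LHS]revK mem_map; last exact: can_inj revK.
    by rewrite !mem_permutations perm_rev.
have S_rev : S = \sum_(r <- permutations (enum E)) (index x (rev r))%:R.
  by rewrite /S -(perm_big _ rev_perm) big_map.
suff : S + S = (#|E|)`!%:R * #|E|.-1%:R by lra.
rewrite {2}S_rev /S -big_split /= (eq_big_seq (fun=> #|E|.-1%:R)).
  rewrite big_const_seq count_predT size_permutations ?enum_uniq // -cardE.
  by rewrite iter_addr addr0 mulr_natl.
move=> r; rewrite mem_permutations => rE.
have ru : uniq r by rewrite (perm_uniq rE) enum_uniq.
have xr : x \in r by rewrite (perm_mem rE) mem_enum.
have sr : size r = #|E| by rewrite (perm_size rE) cardE.
rewrite -natrD; congr (_%:R).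
have ix : (index x r < size r)%N by rewrite index_mem.
suff -> : index x (rev r) = (size r - (index x r).+1)%N by rewrite -sr; lia.
rewrite -[X in index X (rev r)](nth_index x xr).
rewrite -{1}(_ : size r - (size r - (index x r).+1).+1 = index x r)%N; last by lia.
by rewrite -nth_rev ?index_uniq ?size_rev ?rev_uniq //; lia.
Qed.

End SubsetSums.

(** * One step of the game when agent [i] plays [p] and the others [q] *)

Section Deviation.
Variables (R : realType) (n : nat) (w : R) (q p : strategy R) (i : 'I_n).
Hypotheses (w2 : 2 < w) (q_strat : is_strategy n q) (p_strat : is_strategy n p).
Implicit Types (s : game_state n) (f g : game_state n -> R) (E : {set 'I_n}) (r : seq 'I_n).

Let P := deviate (symmetric_profile q) i p.

(** An invariant of play; its last clause keeps [(m, k)] in the range where [is_strategy] makes the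
    entries of [q] and [p] probabilities. *)
Definition valid_state s : Prop :=
  [/\ uniq (queue s), forall j, j \in queue s -> j \notin outside s
    & (#|outside s| + size (queue s) <= n)%N].

Lemma valid_initial : valid_state (initial_state n).
Proof. by split=> //=; rewrite cardsT card_ord addn0. Qed.

Section Step.
Variables (s : game_state n) (E : {set 'I_n}) (r : seq 'I_n).
Hypotheses (s_valid : valid_state s) (E_out : E \subset outside s).
Hypothesis (r_perm : perm_eq r (enum E)).

Lemma mem_entering j : (j \in r) = (j \in E).
Proof. by rewrite (perm_mem r_perm) mem_enum. Qed.

Lemma size_entering : size r = #|E|.
Proof. by rewrite (perm_size r_perm) cardE. Qed.

Lemma outside_next : outside (next_state s r) = outside s :\: E.
Proof. by rewrite /=; congr (_ :\: _); apply/setP => j; rewrite inE mem_entering. Qed.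

Lemma card_outside_next : #|outside (next_state s r)| = (#|outside s| - #|E|)%N.
Proof. by rewrite outside_next cardsDS. Qed.

Lemma size_queue_next :
  size (queue (next_state s r)) = (size (queue s) + #|E|).-1.
Proof. by rewrite /= size_behead size_cat size_entering. Qed.

Lemma uniq_arrivals : uniq (queue s ++ r).
Proof.
case: s_valid => qu qo _.
rewrite cat_uniq qu (perm_uniq r_perm) enum_uniq andbT /=.
apply/hasPn => j; rewrite mem_entering => jE; apply/negP => /qo.
by rewrite (fintype.subsetP E_out _ jE).
Qed.

Lemma valid_next : valid_state (next_state s r).
Proof.
case: (s_valid) => qu qo sn; split.
- by rewrite /= -drop1 drop_uniq // uniq_arrivals.
- move=> j /mem_behead; rewrite outside_next mem_cat inE mem_entering.
  by case/orP => [/qo/negbTE -> | ->] //; rewrite andbF.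
- rewrite card_outside_next size_queue_next.
  by have := subset_leq_card E_out; have := s_valid => -[_ _]; lia.
Qed.

End Step.

Lemma entry_prob_ge0 s E : valid_state s -> 0 <= entry_prob P s E.
Proof.
case=> _ _ sn; apply: prodr_ge0 => j js.
have m1 : (1 <= #|outside s|)%N by apply/card_gt0P; exists j.
have : 0 <= P j #|outside s| (size (queue s)) <= 1.
  by rewrite /P /deviate; case: ifP => _; [apply: p_strat|apply: q_strat].
by case/andP=> x0 x1 /=; case: (j \in E); rewrite ?subr_ge0.
Qed.

Lemma le_step_expectation f g s : valid_state s ->
  (forall s', valid_state s' -> f s' <= g s') ->
  step_expectation P f s <= step_expectation P g s.
Proof.
move=> sv fg; apply: ler_sum => E EO.
apply: ler_wpM2l; first exact: entry_prob_ge0.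
apply: ler_wpM2r; first by rewrite invr_ge0.
rewrite big_seq [leRHS]big_seq; apply: ler_sum => r.
by rewrite mem_permutations => rE; apply/fg/(valid_next sv EO rE).
Qed.

Lemma step_expectationD f g s :
  step_expectation P (fun s' => f s' + g s') s =
  step_expectation P f s + step_expectation P g s.
Proof.
rewrite /step_expectation -big_split; apply: eq_bigr => E _ /=.
by rewrite big_split /= mulrDl mulrDr.
Qed.

Lemma step_expectation0 s : step_expectation P (fun=> 0) s = 0.
Proof. by rewrite /step_expectation big1 // => E _; rewrite big1_eq mul0r mulr0. Qed.

Lemma average_cst E f s c : (forall r, perm_eq r (enum E) -> f (next_state s r) = c) ->
  (\sum_(r <- permutations (enum E)) f (next_state s r)) / ((#|E|)`!)%:R = c.
Proof.
move=> fc; rewrite (eq_big_seq (fun=> c)) => [|r]; last by rewrite mem_permutations => /fc.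
rewrite big_const_seq count_predT size_permutations ?enum_uniq // -cardE iter_addr addr0.
by rewrite -[c *+ _]mulr_natr mulfK // pnatr_eq0 -lt0n fact_gt0.
Qed.

Lemma entry_prob_notin s E (x := q #|outside s| (size (queue s))) : i \notin outside s ->
  entry_prob P s E = \prod_(j in outside s) (if j \in E then x else 1 - x).
Proof.
move=> iO; apply: eq_bigr => j jO; rewrite /P /deviate /symmetric_profile.
by have [ji|//] := eqVneq j i; rewrite -ji jO in iO.
Qed.

Lemma entry_prob_in s E (x := q #|outside s| (size (queue s)))
    (y := p #|outside s| (size (queue s))) : i \in outside s ->
  entry_prob P s E = (if i \in E then y else 1 - y) *
    \prod_(j in outside s :\ i) (if j \in E :\ i then x else 1 - x).
Proof.
move=> iO; rewrite /entry_prob (big_setD1 i) //=; congr (_ * _).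
  by rewrite /P /deviate eqxx.
apply: eq_bigr => j; rewrite !inE => /andP[/negbTE ji _].
by rewrite /P /deviate ji /symmetric_profile.
Qed.

(** Condition on the decision of agent [i]: the entrants among the others are binomial. [F] is taken
    at [#|E|.-1] so that both branches count the others only. *)
Lemma sum_entry_prob_in s (F G : nat -> R)
    (x := q #|outside s| (size (queue s))) (y := p #|outside s| (size (queue s))) :
  i \in outside s ->
  \sum_(E : {set 'I_n} | E \subset outside s)
    entry_prob P s E * (if i \in E then F #|E|.-1 else G #|E|) =
  y * binom_mean #|outside s|.-1 x F + (1 - y) * binom_mean #|outside s|.-1 x G.
Proof.
move=> iO; set O := outside s in iO *.
have cO : #|O|.-1 = #|O :\ i| by rewrite (cardsD1 i O) iO.
rewrite cO -!sum_subset_binom (bigID (fun E : {set 'I_n} => i \in E)) /= !mulr_sumr.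
congr (_ + _).
  rewrite (reindex_onto (fun E => i |: E) (fun E => E :\ i)) /=; last first.
    by move=> E /andP[_ iE]; rewrite finset.setD1K.
  apply: eq_big => [E|E].
    apply/idP/idP.
      case/andP => /andP[iEO _] /eqP <-; rewrite finset.setSD //.
    rewrite finset.subsetD1 => /andP[EO iE].
    by rewrite finset.setU1K // eqxx finset.subUset finset.sub1set iO EO finset.setU11.
  case/andP => /andP[iEO _] /eqP iE.
  by rewrite entry_prob_in // finset.setU11 iE finset.cardsU1 -iE !inE eqxx /= iE mulrA.
apply: eq_big => [E|E /andP[EO /negbTE iE]]; first by rewrite finset.subsetD1.
have Ei : E :\ i = E by apply/setP => j; rewrite !inE; have [->|//] := eqVneq j i.
by rewrite entry_prob_in // iE Ei mulrA.
Qed.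

Lemma sum_entry_prob_notin s : i \notin outside s ->
  \sum_(E : {set 'I_n} | E \subset outside s) entry_prob P s E = 1.
Proof.
move=> iO.
rewrite -(binom_mean_cst #|outside s| (q #|outside s| (size (queue s))) 1).
rewrite -sum_subset_binom; apply: eq_bigr => E _.
by rewrite mulr1 entry_prob_notin.
Qed.

(* With [c j = w * j] a queueing agent is charged his whole remaining cost at once, so
   that only the states in which agent [i] is outside carry a recursion. *)
Definition status_cost (u : nat -> nat -> R) (c : nat -> R) s : R :=
  if i \in outside s then u #|outside s| (size (queue s))
  else if i \in queue s then c (index i (queue s)) else 0.

(** Removing the head shifts every later index down by one, and the head itself leaves without
    paying. *)
Lemma step_cost_queue u c s E r : valid_state s -> E \subset outside s ->
  perm_eq r (enum E) -> i \notin outside s :\: E ->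
  step_cost w i (next_state s r) + status_cost u c (next_state s r) =
  if i \in queue s ++ r then
    if index i (queue s ++ r) is j.+1 then w + c j else 0
  else 0.
Proof.
move=> sv EO rE iO.
rewrite /step_cost /status_cost (outside_next s rE) (negbTE iO) /=.
have := uniq_arrivals sv EO rE.
case: (queue s ++ r) => [|x L] /=; first by rewrite addr0.
case/andP=> xL _; rewrite inE.
have [<-|ix] := eqVneq x i; first by rewrite (negbTE xL) addr0.
by rewrite /=; case: ifP => _; rewrite ?addr0.
Qed.

Lemma step_expectation_notin u c s : valid_state s -> i \notin outside s ->
  step_expectation P (fun s' => step_cost w i s' + status_cost u c s') s =
  if i \in queue s then
    if index i (queue s) is j.+1 then w + c j else 0
  else 0.
Proof.
move=> sv iO; set C := RHS.
rewrite -[C]mul1r -(sum_entry_prob_notin iO) mulr_suml.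
apply: eq_bigr => E EO; congr (_ * _).
apply: (@average_cst E (fun s' => step_cost w i s' + status_cost u c s')) => r rE.
have iE : i \notin E by apply/negP => /(fintype.subsetP EO); apply/negP.
rewrite (step_cost_queue _ _ sv EO rE) ?inE ?(negbTE iO) ?andbF //.
rewrite mem_cat index_cat (mem_entering rE) (negbTE iE) orbF /C.
by case: (i \in queue s).
Qed.

Lemma step_expectation_in u s : valid_state s -> i \in outside s ->
  step_expectation P
    (fun s' => step_cost w i s' + status_cost u (fun j => w * j%:R) s') s =
  round_cost w q p u #|outside s| (size (queue s)).
Proof.
move=> sv iO; set k := size (queue s); set m := #|outside s|.
(* Entering with [e] others puts the agent behind the [k] queued ones and, on average, behind half
   of the [e]. *)
pose F e := w * k%:R + w / 2 * e%:R.
pose G e := 1 + u (m - e)%N (k + e).-1.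
transitivity (\sum_(E : {set 'I_n} | E \subset outside s)
    entry_prob P s E * (if i \in E then F #|E|.-1 else G #|E|)).
  apply: eq_bigr => E EO; congr (_ * _).
  case: ifP => iE; last first.
    apply: (@average_cst E (fun s' => step_cost w i s' + status_cost u _ s')) => r rE.
    rewrite /step_cost /status_cost.
    rewrite (card_outside_next EO rE) (size_queue_next s rE) (outside_next s rE).
    by rewrite inE iE iO.
  rewrite big_seq (eq_bigr (fun r => w * k%:R + w * (index i r)%:R)) -?big_seq => [|r].
    rewrite big_split /= big_const_seq count_predT size_permutations ?enum_uniq // -cardE.
    rewrite -mulr_sumr sum_index_permutations // iter_addr addr0 -[_ *+ (#|E|)`!]mulr_natr /F.
    by field; rewrite pnatr_eq0 -lt0n fact_gt0.
  rewrite mem_permutations => rE.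
  rewrite (step_cost_queue _ _ sv EO rE) ?inE ?iE //.
  case: (sv) => _ qo _.
  have iq : i \notin queue s by apply/negP => /qo; rewrite iO.
  rewrite mem_cat (mem_entering rE) iE orbT index_cat (negbTE iq) -mulrDr -natrD -/k.
  by case: (k + index i r)%N => [|j]; rewrite ?mulr0 // -natr1; ring.
rewrite sum_entry_prob_in // /F /G !binom_mean_affine binom_mean_id.
rewrite /round_cost /enter_cost /wait_cost -/m -/k.
have -> : binom_mean m.-1 (q m k) (fun e => 1 + u (m - e)%N (k + e).-1) =
    1 + binom_mean m.-1 (q m k) (fun e => u (m - e)%N (k + e).-1).
  rewrite -[binom_mean _ _ (fun e => u _ _)]mul1r -binom_mean_affine.
  by congr binom_mean; apply/funext => e; rewrite mul1r.
by congr (_ * _ + _); field.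
Qed.

(** * Total cost against truncated costs of the decision problem *)

Definition partial_cost N s : R :=
  \sum_(t < N) expectation_after P t.+1 (step_cost w i) s.

(** Splits off the first step, whereas the defining sum grows at its last term; the first-step form
    matches the recursion of [cost_upto]. *)
Lemma partial_costS N s : partial_cost N.+1 s =
  step_expectation P (fun s' => step_cost w i s' + partial_cost N s') s.
Proof.
elim: N s => [|N IH] s.
  rewrite /partial_cost big_ord1 /expectation_after /=; congr step_expectation.
  by apply/funext => s'; rewrite big_ord0 addr0.
have -> : partial_cost N.+2 s = partial_cost N.+1 s +
    step_expectation P (expectation_after P N.+1 (step_cost w i)) s.
  by rewrite /partial_cost big_ord_recr.
rewrite IH -step_expectationD.
congr step_expectation; apply/funext => s'.
by rewrite /partial_cost big_ord_recr /= addrA.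
Qed.

Let w0 : 0 <= w := le_trans (ler0n R 2) (ltW w2).

Lemma expectation_after_ge0 t s : valid_state s ->
  0 <= expectation_after P t (step_cost w i) s.
Proof.
elim: t s => [|t IH] s sv.
  by rewrite /= /step_cost; case: ifP => // _; case: ifP.
by rewrite -(step_expectation0 s); apply: le_step_expectation.
Qed.

(** A queueing agent at index [j] pays [w] in each of the next [j] steps, cut off at [N]; an agent
    outside is credited nothing. *)
Lemma status_cost_ge N s : valid_state s ->
  status_cost (fun=> fun=> 0) (fun j => w * (minn N j)%:R) s <= partial_cost N s.
Proof.
elim: N s => [|N IH] s sv.
  rewrite /partial_cost big_ord0 /status_cost.
  by do 2 case: ifP => // _; rewrite min0n mulr0.
rewrite partial_costS.
apply: le_trans (le_step_expectation sv (fun s' sv' => lerD (lexx _) (IH s' sv'))).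
have [iO|iO] := boolP (i \in outside s).
  rewrite {1}/status_cost iO -[leLHS](step_expectation0 s).
  apply: le_step_expectation => // s' sv'.
  apply: addr_ge0; first exact: (expectation_after_ge0 0).
  by rewrite /status_cost; do 2 case: ifP => // _; rewrite mulr_ge0.
rewrite step_expectation_notin // /status_cost (negbTE iO); case: ifP => // _.
by case: (index _ _) => [|j]; rewrite ?minn0 ?mulr0 // minnSS -natr1 mulrDr mulr1 addrC.
Qed.

Let status N := status_cost (cost_upto w q p N) (fun j => w * j%:R).

Lemma status_costS N s : valid_state s ->
  step_expectation P (fun s' => step_cost w i s' + status N s') s = status N.+1 s.
Proof.
move=> sv; rewrite /status /(status_cost (cost_upto _ _ _ N.+1)).
case: ifP => iO; first by rewrite step_expectation_in.
rewrite step_expectation_notin ?iO //; case: ifP => // _.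
by case: (index _ _) => [|j]; rewrite ?mulr0 // -natr1 mulrDr mulr1 addrC.
Qed.

Lemma partial_cost_le N s : valid_state s -> partial_cost N s <= status N s.
Proof.
elim: N s => [|N IH] s sv.
  rewrite /partial_cost big_ord0 /status /status_cost.
  by do 2 case: ifP => // _; rewrite mulr_ge0.
rewrite partial_costS -status_costS //.
by apply: le_step_expectation => // s' sv'; rewrite lerD2l IH.
Qed.

(** After [N] rounds, [n] further steps suffice for any queueing agent to be processed, so that the
    charge made in advance has actually been paid. *)
Lemma status_le_partial_cost N s : valid_state s -> status N s <= partial_cost (N + n) s.
Proof.
elim: N s => [|N IH] s sv.
  apply: le_trans (status_cost_ge n sv).
  rewrite /status /status_cost; case: ifP => // _; case: ifP => // iq.
  case: sv => _ _ sn; rewrite (minn_idPr _) //.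
  by apply: ltnW; apply: leq_trans (_ : size (queue s) <= n)%N; [rewrite index_mem|lia].
rewrite addSn partial_costS -status_costS //.
by apply: le_step_expectation => // s' sv'; rewrite lerD2l IH.
Qed.

(** The sandwich [partial_cost N <= status N <= partial_cost (N + n)] gives both sequences the same
    upper bounds. *)
Lemma expected_cost_leP (M : R) :
  (expected_cost w P i <= M%:E)%E <-> forall N, cost_upto w q p N n 0 <= M.
Proof.
have status0 N : status N (initial_state n) = cost_upto w q p N n 0.
  by rewrite /status /status_cost inE cardsT card_ord.
have partialE N : (\sum_(0 <= t < N)
    (expectation_after P t.+1 (step_cost w i) (initial_state n))%:E)%E =
    (partial_cost N (initial_state n))%:E.
  by rewrite sumEFin big_mkord.
have pos t : (0 <= (expectation_after P t.+1 (step_cost w i) (initial_state n))%:E)%E.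
  by rewrite lee_fin; apply/expectation_after_ge0/valid_initial.
split=> [costM N|costM].
  rewrite -status0; apply: le_trans (status_le_partial_cost N valid_initial) _.
  rewrite -lee_fin -partialE; apply: le_trans costM.
  by apply: nneseries_lim_ge.
apply: lime_le; first by apply: is_cvg_nneseries.
by near=> N; rewrite partialE lee_fin (le_trans (partial_cost_le _ valid_initial)) ?status0.
Unshelve. all: by end_near.
Qed.

End Deviation.

Theorem theorem4p1 (R : realType) :
  exists K : R, 0 < K /\
    forall (w : R) (n : nat) (q : strategy R), 2 < w -> (2 <= n)%N ->
      symmetric_equilibrium n w q ->
      forall i : 'I_n,
        ((n%:R - 1)%:E <= expected_cost w (symmetric_profile q) i
          <= (n%:R + K * w * ln n%:R)%:E)%E.
Proof.
(* [K = 1] works because [w / 2] times the harmonic sum is at most [w / 2] times [2 ln n]. *)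
exists 1; split=> // w n q w2 n2 [q_strat q_eq] i.
have n0 : (0 < n)%N by apply: ltnW.
have selfE : symmetric_profile q = deviate (symmetric_profile q) i q.
  by apply/funext => j; rewrite /deviate; case: ifP.
have costP p M (p_strat : is_strategy n p) := expected_cost_leP i w2 q_strat p_strat M.
have q_optimal p M : is_strategy n p -> (forall N, cost_upto w q p N n 0 <= M) ->
    forall N, cost_upto w q q N n 0 <= M.
  move=> p_strat /costP costM; apply/costP => //; rewrite -selfE.
  by apply: le_trans (costM p_strat); rewrite leNgt; apply/negP/q_eq.
have ln_n := harmonic_sum_le_ln R n.-1; rewrite prednK // in ln_n.
apply/andP; split; last first.
  rewrite selfE; apply/(costP _ _ q_strat)/q_optimal.
    exact: late_entry_strategy.
  move=> N; apply: (le_trans (late_entry_bound w2 q_strat N n0 _)).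
    by rewrite addn0.
  rewrite addn0 mul1r; apply: lerD; first by rewrite ler_nat leq_pred.
  have w0 : 0 <= w / 2 by lra.
  have := ler_wpM2l w0 ln_n; lra.
have value_init_ge : n%:R - 1 <= value w q n 0.
  have := value_ge w2 q_strat n0 q_optimal (reachable_init n q).
  by rewrite addn0 -[in n%:R](prednK n0) -natr1 addrK.
rewrite leNgt; apply/negP => cost_lt.
(* Every real upper bound of the cost is at least [n - 1]. A finite cost is its own bound; for [-oo]
   the bound [n - 2] gives the contradiction. *)
have cost_le M : (expected_cost w (symmetric_profile q) i <= M%:E)%E -> n%:R - 1 <= M.
  rewrite selfE => /(costP _ _ q_strat) leM; apply: le_trans value_init_ge _.
  exact: (value_le w2 q_strat n0 q_optimal (reachable_init n q)).
move: cost_lt cost_le; case: expected_cost => [c||] //.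
  by rewrite lte_fin => c_lt /(_ c (lexx _)); rewrite leNgt c_lt.
by move=> _ /(_ (n%:R - 2) (leNye _)); lra.
Qed.
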